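(* Let $q \geq 3$ be a prime, let $a \in \{0,1\}$ and $N = 2^a q$, let $r$ be a nonzero integer constant and $t$ an indeterminate. Define $$\mathcal{F}_{N,t}(x) := \Phi_N(x) + 4rq^2 t\, x^{\phi(N)/2},$$ where $\Phi_N$ is the $N$-th cyclotomic polynomial and $\phi$ is Euler's totient function, and define $$g_0(u) = 4rq^2t + 1 + 2\sum_{j=1}^{(q-1)/2} T_j(u/2), \qquad g_1(u) = 4rq^2t + (-1)^{(q-1)/2}\Big(1 + 2\sum_{j=1}^{(q-1)/2} (-1)^j T_j(u/2)\Big),$$ where $T_j$ denotes the $j$-th Chebyshev polynomial of the first kind. Then $$\Delta(\mathcal{F}_{q,t}) = q(4qrt+1)\big(4q^2rt + (-1)^{(q-1)/2}\big)\,\Delta(g_0)^2$$ and $$\Delta(\mathcal{F}_{2q,t}) = q\big(4qrt+(-1)^{(q-1)/2}\big)(4q^2rt + 1)\,\Delta(g_1)^2,$$ where $\Delta(\cdot)$ denotes the polynomial discriminant (computed over $\mathbb{Z}[t]$, i.e. as polynomials in $x$ resp. $u$ with coefficients in $\mathbb{Z}[t]$).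
   Context: Chebyshev polynomials of the first kind: $T_0(x)=1$, $T_1(x)=x$, $T_n(x) = 2xT_{n-1}(x) - T_{n-2}(x)$ for $n\ge 2$. The discriminant of a polynomial $h$ of degree $n$ with leading coefficient $a_n$ and roots $\alpha_1,\dots,\alpha_n$ is $\Delta(h)=a_n^{2n-2}\prod_{i<j}(\alpha_i-\alpha_j)^2$. The polynomial $g_a$ satisfies $\mathcal{F}_{2^aq,t}(x) = x^{(q-1)/2} g_a(x+x^{-1})$. *)

(* Defs.v *)
From HB Require Import structures.
From mathcomp Require Import all_boot all_order all_algebra all_field.

Set Implicit Arguments.
Unset Strict Implicit.
Unset Printing Implicit Defensive.

Import GRing.Theory.
Local Open Scope quotient_scope.
Local Open Scope ring_scope.

Fixpoint chebyshevT (R : nzRingType) (n : nat) : {poly R} :=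
  match n with
  | 0 => 1
  | S m => match m with
           | 0 => 'X
           | S k => 2%:R *: 'X * chebyshevT R m - chebyshevT R k
           end
  end.

(* [s] is the list of the roots of [h], repeated according to multiplicity;
   [size h] is the degree plus one. *)
Definition discriminant (K : closedFieldType) (h : {poly K}) : K :=
  let s := sval (closed_field_poly_normal h) in
  let n := (size h).-1 in
  lead_coef h ^+ (2 * n - 2)
    * \prod_(i < size s) \prod_(j < size s | (i < j)%N) (s`_i - s`_j) ^+ 2.

(* Q(t), the field of fractions of Z[t].  It is used as the coefficient field
   because T_j(u/2) does not have integral coefficients. *)
Definition Qt : fieldType := {fraction {poly int}}.

Definition t : Qt := tofrac ('X : {poly int}).

Definition discriminant_in (K : closedFieldType) (iota : {rmorphism Qt -> K})
    (h : {poly Qt}) : K :=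
  discriminant (map_poly iota h).

Definition calF (N q : nat) (r : int) : {poly Qt} :=
  map_poly intr 'Phi_N
  + (4%:R * r%:~R * q%:R ^+ 2 * t)%:P * 'X^((totient N)./2).

Definition chebyshevT_half (j : nat) : {poly Qt} :=
  chebyshevT Qt j \Po (2%:R^-1 *: 'X).

Definition g0 (q : nat) (r : int) : {poly Qt} :=
  (4%:R * r%:~R * q%:R ^+ 2 * t)%:P
  + 1 + 2%:R *: \sum_(1 <= j < (q.-1)./2.+1) chebyshevT_half j.

Definition g1 (q : nat) (r : int) : {poly Qt} :=
  (4%:R * r%:~R * q%:R ^+ 2 * t)%:P
  + (-1) ^+ (q.-1)./2
    *: (1 + 2%:R *: \sum_(1 <= j < (q.-1)./2.+1)
                      (-1) ^+ j *: chebyshevT_half j).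

(* Q(t) has an algebraic closure (and every ring morphism out of it is
   injective), so quantifying over such [K] is not vacuous. *)
Lemma Qt_closure : exists K : closedFieldType, inhabited {rmorphism Qt -> K}.
Proof.
pose f (x : Qt) : {poly int} * {poly int} := frac (repr x).
pose g p : Qt := \pi_{fraction {poly int}} (Ratio p.1 p.2).
have fK : cancel f g by move=> x; rewrite /g /f Ratio_numden reprK.
pose F : countFieldType :=
  HB.pack (Qt : Type) (GRing.Field.on Qt) (CanIsCountable fK).
have [K [h _]] := countable_algebraic_closure F.
by exists K; split; exact: h.
Qed.

(* Main.v *)
(* With m = (q - 1) / 2 we have F(x) = x^m g(x + 1/x) for a monic g of degree m,
   so the roots of F are the pairs a, 1/a with u = a + 1/a a root of g. A pair
   contributes (a - 1/a)^2 = u^2 - 4 to the discriminant, and two pairs over u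
   and v contribute (u - v)^4. Hence
     disc F = g(2) g(-2) (disc g)^2 = (-1)^m F(1) F(-1) (disc g)^2,
   and F(1), F(-1) are explicit because Phi_q(x) = 1 + x + ... + x^(q-1) and
   Phi_2q(x) = Phi_q(-x). *)
Require Import Defs.
From HB Require Import structures.
From mathcomp Require Import all_boot all_order all_algebra all_field ring zify.

Set Implicit Arguments.
Unset Strict Implicit.
Unset Printing Implicit Defensive.

Import GRing.Theory.
Local Open Scope ring_scope.

(** * Discriminants as squared Vandermonde products over root lists *)

Fixpoint sqr_vandermonde (K : fieldType) (s : seq K) : K :=
  if s is x :: s' then \prod_(y <- s') (x - y) ^+ 2 * sqr_vandermonde s' else 1.

Lemma sqr_vandermondeE (K : fieldType) (s : seq K) :
  \prod_(i < size s) \prod_(j < size s | (i < j)%N) (s`_i - s`_j) ^+ 2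
    = sqr_vandermonde s.
Proof.
elim: s => [|x s IHs] /=; first by rewrite big_ord0.
rewrite big_ord_recl /= -IHs; congr (_ * _).
  by rewrite big_mkcond big_ord_recl /= mul1r (big_nth 0) big_mkord.
apply: eq_bigr => i _; rewrite big_mkcond big_ord_recl /= mul1r [RHS]big_mkcond.
by apply: eq_bigr.
Qed.

Lemma sqr_vandermonde_cat (K : fieldType) (s1 s2 : seq K) :
  sqr_vandermonde (s1 ++ s2) = sqr_vandermonde s1 * sqr_vandermonde s2
    * \prod_(x <- s1) \prod_(y <- s2) (x - y) ^+ 2.
Proof.
elim: s1 => [|x s1 IHs] /=; first by rewrite big_nil mul1r mulr1.
by rewrite IHs big_cat big_cons /=; ring.
Qed.

(** [discriminant] uses one chosen list of roots; this makes any other factorization usable. Moving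
    [x] out of [u ++ x :: v] only replaces factors (y - x)^2 by (x - y)^2. *)
Lemma sqr_vandermonde_perm (K : fieldType) (s1 s2 : seq K) :
  perm_eq s1 s2 -> sqr_vandermonde s1 = sqr_vandermonde s2.
Proof.
elim: s1 s2 => [|x s1 IHs] s2; first by rewrite perm_sym => /perm_nilP->.
move=> eq12; have xs2 : x \in s2 by rewrite -(perm_mem eq12) mem_head.
case/splitPr: xs2 eq12 => u v.
rewrite -(cat1s x v) perm_sym perm_catCA perm_cons => eq12.
rewrite /= (IHs (u ++ v)) 1?perm_sym // !sqr_vandermonde_cat /=.
have -> : \prod_(y <- u) \prod_(z <- x :: v) (y - z) ^+ 2
    = \prod_(y <- u) (x - y) ^+ 2 * \prod_(y <- u) \prod_(z <- v) (y - z) ^+ 2.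
  rewrite -big_split; apply: eq_bigr => y _.
  by rewrite big_cons -sqrrN opprB.
rewrite (perm_big (u ++ v)) 1?perm_sym // big_cat /=; ring.
Qed.

Lemma discriminant_prod_XsubC (K : closedFieldType) (s : seq K) :
  discriminant (\prod_(z <- s) ('X - z%:P)) = sqr_vandermonde s.
Proof.
rewrite /discriminant; case: closed_field_poly_normal => s' /=.
have /monicP -> : \prod_(z <- s) ('X - z%:P) \is monic by exact: monic_prod_XsubC.
rewrite scale1r expr1n mul1r sqr_vandermondeE => /prod_XsubC_eq eqs.
by rewrite (sqr_vandermonde_perm eqs).
Qed.

(** * Self-reciprocal polynomials and the substitution u = x + 1/x *)

Definition with_inverses (K : fieldType) (s : seq K) : seq K :=
  flatten [seq [:: a; a^-1] | a <- s].

(* Each pair u = a + 1/a, v = b + 1/b contributes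
   (a - b) (a - 1/b) (1/a - b) (1/a - 1/b) = (u - v)^2. *)
Lemma sqr_vandermonde_add_inv (K : fieldType) (s : seq K) :
  all (fun a => a != 0) s ->
  sqr_vandermonde (with_inverses s)
    = \prod_(a <- s) ((a + a^-1) ^+ 2 - 4%:R)
      * sqr_vandermonde [seq a + a^-1 | a <- s] ^+ 2.
Proof.
elim: s => [|a s IHs] /=; first by rewrite big_nil expr1n mulr1.
case/andP=> a0 s0; rewrite /with_inverses /= -/(with_inverses s) IHs //.
rewrite !big_cons.
have big2 (f : K -> K) : \prod_(y <- with_inverses s) f y
    = \prod_(b <- s) (f b * f b^-1).
  rewrite big_flatten big_map; apply: eq_bigr => b _.
  by rewrite !big_cons big_nil /= mulr1.
have cross : \prod_(y <- with_inverses s) (a - y) ^+ 2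
             * \prod_(y <- with_inverses s) (a^-1 - y) ^+ 2
    = (\prod_(v <- [seq b + b^-1 | b <- s]) (a + a^-1 - v) ^+ 2) ^+ 2.
  rewrite !big2 -big_split /= -prodrXl big_map; apply: eq_big_seq => b bs.
  by have b0 := allP s0 b bs; field; rewrite a0 b0.
rewrite exprMn -cross; set P := \prod_(y <- _) _; set Q := \prod_(y <- _) _.
by field.
Qed.

(* If p <> q then 'X * (p - q) + 1 is not constant, so it has a root, which is
   nonzero and separates p from q. *)
Lemma eq_poly_neq0 (K : closedFieldType) (p q : {poly K}) :
  (forall x, x != 0 -> p.[x] = q.[x]) -> p = q.
Proof.
move=> eqpq; apply/eqP; rewrite -subr_eq0; apply: contraT => pq0.
have /closed_rootP[x] : size ('X * (p - q) + 1) != 1.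
  rewrite size_polyDl mulrC size_mulX ?size_poly1 ?eqSS ?size_poly_eq0 //.
  by rewrite ltnS size_poly_gt0.
rewrite /root !hornerE; have [->|/eqpq->] := eqVneq x 0.
  by rewrite mul0r add0r oner_eq0.
by rewrite subrr mulr0 add0r oner_eq0.
Qed.

(** Take a root of X^2 - u X + 1, nonzero because of the constant term. The sigma type lets the
    choice be mapped over a list of roots. *)
Lemma quadratic_add_inv (K : closedFieldType) (u : K) :
  {a : K | a != 0 & a + a^-1 = u}.
Proof.
have sz : size ('X^2 + (1 - u *: 'X) : {poly K}) = 3%N.
  rewrite size_polyDl size_polyXn // (leq_ltn_trans (size_polyD _ _)) //.
  rewrite size_poly1 size_polyN gtn_max /=.
  by rewrite (leq_ltn_trans (size_scale_leq _ _)) ?size_polyX.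
have /closed_rootP/sigW[a] : size ('X^2 + (1 - u *: 'X) : {poly K}) != 1 by rewrite sz.
rewrite /root !hornerE /= => /eqP ra.
have a0 : a != 0.
  by apply: contra_eq_neq ra => ->; rewrite expr0n mulr0 subr0 add0r oner_neq0.
exists a => //; apply: (mulfI a0); rewrite mulrDr mulfV //.
by apply/eqP; rewrite -subr_eq0 -ra; apply/eqP; ring.
Qed.

Lemma discriminant_reciprocal (K : closedFieldType) (m : nat) (f g : {poly K}) :
    g \is monic -> size g = m.+1 ->
    (forall x, x != 0 -> f.[x] = x ^+ m * g.[x + x^-1]) ->
  discriminant f = (-1) ^+ m * f.[1] * f.[-1] * discriminant g ^+ 2.
Proof.
move=> g_monic size_g fE.
have [us gE] := closed_field_poly_normal g.
rewrite (monicP g_monic) scale1r in gE.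
have size_us : size us = m by move: size_g; rewrite gE size_prod_XsubC => -[].
pose s := [seq s2val (quadratic_add_inv u) | u <- us].
have s0 : all (fun a => a != 0) s.
  by apply/allP => _ /mapP[u _ ->]; case: quadratic_add_inv.
have usE : us = [seq a + a^-1 | a <- s].
  rewrite -map_comp -[LHS]map_id; apply: eq_map => u /=.
  by case: quadratic_add_inv.
have size_s : size s = m by rewrite size_map.
clearbody s.
(* Each root a + 1/a of [g] takes one factor of x^m: x (x + 1/x - a - 1/a) = (x - a) (x - 1/a). *)
have f_fact : f = \prod_(z <- with_inverses s) ('X - z%:P).
  apply: eq_poly_neq0 => x x0; rewrite fE // gE usE -size_s !horner_prod.
  rewrite big_flatten !big_map.
  elim: {usE size_s} s s0 => [|a s IHs] /=; first by rewrite !big_nil mulr1.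
  case/andP=> a0 s0; rewrite !big_cons -IHs // exprS big_nil !hornerE /=.
  by field; rewrite x0 a0.
rewrite {1}f_fact discriminant_prod_XsubC sqr_vandermonde_add_inv //.
rewrite -usE -discriminant_prod_XsubC -gE; congr (_ * _).
(* Here f(1) = g(2) and f(-1) = (-1)^m g(-2), so the signs cancel and g(2) g(-2) is the product of
   the u^2 - 4. *)
rewrite !fE ?oppr_eq0 ?oner_eq0 // invrN1 invr1 expr1n mul1r mulrACA.
rewrite -expr2 sqrr_sign mul1r gE usE !horner_prod !big_map -big_split.
by apply: eq_bigr => a _ /=; rewrite !hornerE /=; ring.
Qed.

(** * Rescaled Chebyshev polynomials and their sums *)

Lemma map_chebyshevT (R S : nzRingType) (f : {rmorphism R -> S}) (n : nat) :
  map_poly f (chebyshevT R n) = chebyshevT S n.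
Proof.
elim/ltn_ind: n => -[|[|n]] IHn.
- by rewrite /= rmorph1.
- by rewrite /= map_polyX.
rewrite [LHS]/= rmorphB rmorphM /= map_polyZ map_polyX rmorph_nat.
by rewrite -/(chebyshevT R n.+1) !IHn.
Qed.

(** The Dickson polynomial D_n(u, 1), characterized by D_n(x + 1/x) = x^n + x^(-n). Unlike T_n, it
    is monic for n > 0. *)
Definition dickson (F : fieldType) (n : nat) : {poly F} :=
  2%:R *: (chebyshevT F n \Po (2%:R^-1 *: 'X)).

Section Dickson.
Variables (F : fieldType) (two_neq0 : 2%:R != 0 :> F).

Lemma dickson0 : dickson F 0 = 2%:R%:P.
Proof. by rewrite /dickson /= comp_polyC alg_polyC. Qed.

Lemma dickson1 : dickson F 1 = 'X.
Proof. by rewrite /dickson /= comp_polyX scalerA divff // scale1r. Qed.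

Lemma dicksonSS n : dickson F n.+2 = 'X * dickson F n.+1 - dickson F n.
Proof.
rewrite /dickson [chebyshevT F n.+2]/= comp_polyB comp_polyM comp_polyZ comp_polyX.
by rewrite scalerA divff // scale1r scalerBr scalerAr.
Qed.

Lemma horner_dickson n x : x != 0 -> (dickson F n).[x + x^-1] = x ^+ n + x ^- n.
Proof.
move=> x0; elim/ltn_ind: n => -[|[|n]] IHn.
- by rewrite dickson0 hornerC expr0 invr1.
- by rewrite dickson1 hornerX expr1.
- rewrite dicksonSS hornerD hornerN hornerM hornerX !IHn // -!exprVn !exprS.
  by field.
Qed.

Lemma dickson_monic n : (dickson F n.+1 \is monic) && (size (dickson F n.+1) == n.+2).
Proof.
elim/ltn_ind: n => -[|n] IHn; first by rewrite dickson1 monicX size_polyX.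
have /andP[mon_n /eqP size_n] := IHn n (ltnSn n).
have size_lt : (size (- dickson F n)%R < size ('X * dickson F n.+1)%R)%N.
  rewrite mulrC size_mulX ?monic_neq0 // size_n size_polyN.
  (* The subtracted term may be D_0 = 2, which the induction hypothesis does not cover. *)
  case: n IHn {mon_n size_n} => [|n] IHn.
    by rewrite dickson0 (leq_ltn_trans (size_polyC_leq1 _)).
  by have /andP[_ /eqP->] := IHn n (leqW (ltnSn n)).
rewrite dicksonSS size_polyDl // mulrC size_mulX ?monic_neq0 // size_n eqxx andbT.
rewrite qualifE /= lead_coefDl 1?mulrC // lead_coefM lead_coefX mul1r.
by apply/eqP/monicP.
Qed.

(* For e = 1 this is g_0, and for e = -1 it is g_1. *)
Definition dickson_sum (c e : F) (m : nat) : {poly F} :=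
  c%:P + e ^+ m *: (1 + \sum_(1 <= j < m.+1) e ^+ j *: dickson F j).

(** The outer factor e^m cancels the e^m on the top term D_m; everything else, collected in [p], has
    degree below m. *)
Lemma dickson_sum_monic c e m : e * e = 1 -> (0 < m)%N ->
  (dickson_sum c e m \is monic) && (size (dickson_sum c e m) == m.+1).
Proof.
move=> ee; case: m => // m _.
have /andP[mon_m /eqP size_m] := dickson_monic m.
pose p : {poly F} :=
  c%:P + e ^+ m.+1 *: (1 + \sum_(1 <= j < m.+1) e ^+ j *: dickson F j).
have -> : dickson_sum c e m.+1 = dickson F m.+1 + p.
  rewrite /dickson_sum big_nat_recr //= addrA scalerDr scalerA -exprMn ee expr1n.
  by rewrite scale1r addrA addrC.
have size_p : (size p < m.+2)%N.
  rewrite ltnS (leq_trans (size_polyD _ _)) // geq_max.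
  rewrite (leq_trans (size_polyC_leq1 _)) //= (leq_trans (size_scale_leq _ _)) //.
  rewrite (leq_trans (size_polyD _ _)) // geq_max size_poly1 /=.
  rewrite big_nat; elim/big_ind: _ => [|u v Hu Hv|j /andP[j0 jm]].
  - by rewrite size_poly0.
  - by rewrite (leq_trans (size_polyD _ _)) // geq_max Hu.
  rewrite (leq_trans (size_scale_leq _ _)) //; case: j j0 jm => // j _ jm.
  by have /andP[_ /eqP->] := dickson_monic j.
rewrite size_polyDl size_m // eqxx andbT qualifE /= lead_coefDl ?size_m //.
Qed.

(** Since 1/e = e, putting y = e x turns the sum into the Laurent sum of y^j for -m <= j <= m, and
    the factor (e x)^m shifts it to a geometric sum. *)
Lemma horner_dickson_sum c e m x : e * e = 1 -> x != 0 ->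
  x ^+ m * (dickson_sum c e m).[x + x^-1]
    = c * x ^+ m + \sum_(i < m.*2.+1) (e * x) ^+ i.
Proof.
move=> ee x0.
have e0 : e != 0.
  by apply: contra_eq_neq ee => ->; rewrite mul0r eq_sym oner_neq0.
have y0 : e * x != 0 by rewrite mulf_neq0.
rewrite /dickson_sum hornerD hornerC hornerZ hornerD -[1]/(1%:P) hornerC horner_sum.
rewrite mulrDr [x ^+ m * c]mulrC mulrA -exprMn [x * e]mulrC; congr (_ + _).
have eV : e^-1 = e by apply: (mulfI e0); rewrite ee divff.
rewrite mulrC in y0 *; set y := x * e in y0 *.
have -> : \sum_(1 <= j < m.+1) (e ^+ j *: dickson F j).[x + x^-1]
    = \sum_(1 <= j < m.+1) (y ^+ j + y ^- j).
  apply: eq_bigr => j _; rewrite hornerZ horner_dickson //.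
  by rewrite mulrDr -exprMn -!exprVn -exprMn -{2}eV -invfM [e * x]mulrC.
elim: m => [|m IHm]; first by rewrite big_nil big_ord1 addr0 mulr1.
(* The first and last terms are split off; the middle of the new geometric sum is y times the old
   one. *)
rewrite big_nat_recr //= doubleS big_ord_recr big_ord_recl /=.
have -> : \sum_(i < m.*2.+1) y ^+ bump 0 i = y * \sum_(i < m.*2.+1) y ^+ i.
  by rewrite mulr_sumr; apply: eq_bigr => i _; rewrite -exprS.
rewrite -IHm addrA; set S := 1 + _.
have -> : y ^+ m.*2.+2 = y ^+ m.+1 * y ^+ m.+1.
  by rewrite -exprD -addnn addnS addSn.
rewrite exprS expr0; field.
by rewrite y0 expf_neq0.
Qed.

End Dickson.

(** * Cyclotomic polynomials of index q and 2q *)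

Lemma Cyclotomic1 : 'Phi_1 = 'X - 1 :> {poly int}.
Proof. by have := @prod_Cyclotomic 1 isT; rewrite big_seq1 expr1. Qed.

Lemma Cyclotomic_prime (q : nat) : prime q -> 'Phi_q = \sum_(i < q) 'X^i.
Proof.
move=> q_pr; have := prod_Cyclotomic (prime_gt0 q_pr).
have divs : perm_eq (divisors q) [:: 1%N; q].
  apply: uniq_perm => [||d]; first exact: divisors_uniq.
    by rewrite /= inE andbT neq_ltn prime_gt1.
  rewrite -dvdn_divisors ?prime_gt0 // !inE; apply/idP/idP.
    by case/primeP: q_pr => _ /[apply].
  by case/orP=> /eqP->; rewrite ?dvd1n ?dvdnn.
rewrite (perm_big _ divs) !big_cons big_nil /= mulr1 Cyclotomic1 subrX1.
by apply/mulfI/monic_neq0/monicXsubC.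
Qed.

(** X^(2q) - 1 is the product of the cyclotomic polynomials of index 1, 2, q and 2q. As q is odd,
    X^q + 1 = (X + 1) times the alternating sum; cancelling X - 1, X + 1 and Phi_q leaves the
    claim. *)
Lemma Cyclotomic_double_prime (q : nat) : prime q -> odd q ->
  'Phi_(2 * q) = \sum_(i < q) (- 'X) ^+ i.
Proof.
move=> q_pr q_odd; have q_gt0 := prime_gt0 q_pr; have q_gt1 := prime_gt1 q_pr.
have dvd_q d : (d %| q)%N = (d == 1%N) || (d == q).
  apply/idP/idP; first by case/primeP: q_pr => _ /[apply].
  by case/orP=> /eqP->; rewrite ?dvd1n ?dvdnn.
have := @prod_Cyclotomic (2 * q) _; rewrite muln_gt0 q_gt0 => /(_ isT).
have divs : perm_eq (divisors (2 * q)) [:: 1%N; 2%N; q; (2 * q)%N].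
  apply: uniq_perm => [||d]; first exact: divisors_uniq.
    have q2 : q != 2%N by apply: contraTneq q_odd => ->.
    rewrite /= !inE; lia.
  rewrite -dvdn_divisors ?muln_gt0 // !inE; apply/idP/idP; last first.
    by case/or4P => /eqP->; [exact: dvd1n | exact: dvdn_mulr | exact: dvdn_mull |].
  have [/dvdnP[e ->]|d_odd] := boolP (2 %| d)%N.
    rewrite mulnC dvdn_pmul2l // dvd_q => /orP[] /eqP->; first by rewrite eqxx !orbT.
    by rewrite eqxx !orbT.
  rewrite Gauss_dvdr ?dvd_q; first by case/orP=> ->; rewrite ?orbT.
  by rewrite coprimen2 -[odd d]negbK -dvdn2.
rewrite (perm_big _ divs) !big_cons big_nil /= mulr1 Cyclotomic1.
rewrite (Cyclotomic_prime (isT : prime 2)) (Cyclotomic_prime q_pr).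
rewrite big_ord_recl big_ord1 expr0 expr1 mulnC exprM subr_sqr_1 subrX1.
set S := \sum_(i < q) 'X^i; set U := \sum_(i < q) _; set P := 'Phi_ _ => eqP.
have S_neq0 : S != 0 by rewrite /S -Cyclotomic_prime // monic_neq0 ?Cyclotomic_monic.
have X1_neq0 (e : int) : 'X - e%:P != 0 by apply/monic_neq0/monicXsubC.
apply: (mulfI (X1_neq0 1)); apply: (mulfI S_neq0); apply: (mulfI (X1_neq0 (-1))).
rewrite polyCN opprK polyC1.
have := subrX1 (- 'X : {poly int}) q; rewrite -/U exprNn -signr_odd q_odd => eqU.
have -> : ('X + 1) * (S * (('X - 1) * U)) = ('X - 1) * S * - ((- 'X - 1) * U).
  by ring.
by rewrite -eqU mulN1r -opprD opprK -eqP; ring.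
Qed.

(** * Specialization to the two families over Q(t) *)

Lemma discriminant_dickson_sum (K : closedFieldType) (c e : K) (m : nat)
    (f : {poly K}) :
    2%:R != 0 :> K -> e * e = 1 -> (0 < m)%N ->
    (forall x, f.[x] = c * x ^+ m + \sum_(i < m.*2.+1) (e * x) ^+ i) ->
  discriminant f
    = (-1) ^+ m * f.[1] * f.[-1] * discriminant (dickson_sum c e m) ^+ 2.
Proof.
move=> two0 ee m0 fE.
have /andP[g_monic /eqP size_g] := dickson_sum_monic two0 c ee m0.
apply: discriminant_reciprocal => // x x0.
by rewrite fE horner_dickson_sum.
Qed.

Lemma sum_signr_odd (R : pzRingType) (m : nat) :
  \sum_(i < m.*2.+1) (-1) ^+ i = 1 :> R.
Proof.
elim: m => [|m IHm]; first by rewrite big_ord1.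
rewrite doubleS big_ord_recr big_ord_recr /= IHm.
rewrite -(signr_odd _ m.*2.+1) -(signr_odd _ m.*2.+2).
by rewrite /= odd_double /= expr1 expr0 subrK.
Qed.

Lemma two_neq0_Qt (K : closedFieldType) (iota : {rmorphism Qt -> K}) :
  2%:R != 0 :> K.
Proof.
rewrite -(rmorph_nat iota) fmorph_eq0 -(rmorph_nat (@tofrac {poly int})).
by rewrite tofrac_eq0 -polyC_natr polyC_eq0.
Qed.

Lemma horner_map_calF (K : closedFieldType) (iota : {rmorphism Qt -> K})
    (N q : nat) (r : int) (x : K) :
  (map_poly iota (calF N q r)).[x]
    = iota (4%:R * r%:~R * q%:R ^+ 2 * t) * x ^+ (totient N)./2
      + (map_poly intr 'Phi_N).[x].
Proof.
rewrite /calF rmorphD rmorphM /= map_polyC map_polyXn hornerD hornerM hornerC hornerXn.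
rewrite addrC -map_poly_comp; congr (_ + _.[x]).
by apply: eq_map_poly => z /=; rewrite rmorph_int.
Qed.

Lemma map_dickson_sum (K : closedFieldType) (iota : {rmorphism Qt -> K})
    (c e : Qt) (m : nat) :
  map_poly iota (c%:P + e ^+ m *:
      (1 + 2%:R *: \sum_(1 <= j < m.+1) e ^+ j *: chebyshevT_half j))
    = dickson_sum (iota c) (iota e) m.
Proof.
rewrite /dickson_sum rmorphD /= map_polyC map_polyZ rmorphD rmorph1 rmorphXn /=.
congr (_ + _ *: (1 + _)); rewrite map_polyZ rmorph_nat rmorph_sum scaler_sumr.
apply: eq_bigr => j _ /=; rewrite map_polyZ rmorphXn /chebyshevT_half map_comp_poly.
rewrite map_chebyshevT map_polyZ map_polyX fmorphV rmorph_nat /dickson.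
by rewrite !scalerA mulrC.
Qed.

Theorem theorem1p3 (K : closedFieldType) (iota : {rmorphism Qt -> K})
    (q : nat) (r : int) (q_prime : prime q) (q_ge3 : (3 <= q)%N)
    (r_neq0 : r != 0) :
  discriminant_in iota (calF q q r)
    = iota (q%:R * (4%:R * q%:R * r%:~R * t + 1)
            * (4%:R * q%:R ^+ 2 * r%:~R * t + (-1) ^+ (q.-1)./2))
      * discriminant_in iota (g0 q r) ^+ 2
  /\
  discriminant_in iota (calF (2 * q) q r)
    = iota (q%:R * (4%:R * q%:R * r%:~R * t + (-1) ^+ (q.-1)./2)
            * (4%:R * q%:R ^+ 2 * r%:~R * t + 1))
      * discriminant_in iota (g1 q r) ^+ 2.
Proof.
have q_odd : odd q by case: (even_prime q_prime) q_ge3 => [->|].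
set m := (q.-1)./2.
have qE : q = m.*2.+1.
  by rewrite /m halfK -subn1 oddB ?prime_gt0 // q_odd subn0 subn1 prednK ?prime_gt0.
have m_gt0 : (0 < m)%N by move: q_ge3; rewrite {1}qE; case: (m).
have sqN1 : (-1) ^+ m * (-1) ^+ m = 1 :> K by rewrite -expr2 sqrr_sign.
set c := 4%:R * r%:~R * q%:R ^+ 2 * t.
have sum1 : \sum_(i < m.*2.+1) 1 ^+ i = q%:R :> K.
  by under eq_bigr do rewrite expr1n; rewrite sumr_const card_ord -qE.
have iotaE := (rmorphM iota, rmorphD iota, rmorph1 iota, rmorph_nat iota,
  rmorph_int iota, rmorphXn iota, rmorphN iota).
have two0 := two_neq0_Qt iota.
rewrite /discriminant_in; split.
  (* Powers of e = 1 are inserted to match [map_dickson_sum]. *)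
  have -> : g0 q r = c%:P + 1 ^+ m *:
      (1 + 2%:R *: \sum_(1 <= j < m.+1) 1 ^+ j *: chebyshevT_half j).
    rewrite /g0 -/c -/m -addrA expr1n scale1r; congr (_ + (_ + _ *: _)).
    by apply: eq_bigr => j _; rewrite expr1n scale1r.
  have FE x : (map_poly iota (calF q q r)).[x]
      = iota c * x ^+ m + \sum_(i < m.*2.+1) (iota 1 * x) ^+ i.
    rewrite horner_map_calF totient_prime // -/m -/c Cyclotomic_prime // -qE.
    rewrite rmorph_sum horner_sum; congr (_ + _); apply: eq_bigr => i _ /=.
    by rewrite map_polyXn hornerXn rmorph1 mul1r.
  rewrite map_dickson_sum (discriminant_dickson_sum two0 _ m_gt0 FE) ?rmorph1 ?mulr1 //.
  (* F(1) = c + q = q (4qrt + 1), and (-1)^m F(-1) = c + (-1)^m. *)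
  congr (_ * _); rewrite !FE expr1n rmorph1 mulr1 !mul1r sum1 sum_signr_odd.
  rewrite /c !iotaE; ring: sqN1.
have -> : g1 q r = c%:P + (-1) ^+ m *:
    (1 + 2%:R *: \sum_(1 <= j < m.+1) (-1) ^+ j *: chebyshevT_half j) by [].
have FE x : (map_poly iota (calF (2 * q) q r)).[x]
    = iota c * x ^+ m + \sum_(i < m.*2.+1) (iota (-1) * x) ^+ i.
  rewrite horner_map_calF totient_coprime ?coprime2n // !totient_prime // mul1n.
  rewrite -/m -/c Cyclotomic_double_prime // -qE.
  rewrite rmorph_sum horner_sum; congr (_ + _); apply: eq_bigr => i _ /=.
  by rewrite rmorphXn rmorphN /= map_polyX horner_exp hornerN hornerX rmorphN1 mulN1r.
rewrite map_dickson_sum (discriminant_dickson_sum two0 _ m_gt0 FE); last first.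
  by rewrite rmorphN1 mulrNN mulr1.
(* The two values of the sum trade places: F(1) = c + 1, and (-1)^m F(-1) = c + (-1)^m q, from which
   q is factored out. *)
congr (_ * _); rewrite !FE expr1n rmorphN1 mulrNN !mulr1 sum1 sum_signr_odd.
rewrite /c !iotaE; ring: sqN1.
Qed.
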